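(* Let $\mathcal L$ be a 2-z-exact 2-category and let $A\xrightarrow{f}B\xrightarrow{g}C$ be a pair of composable normal 1-cells with normal image factorisations $f\cong\mathrm{im}(f)\circ\mathrm{coim}(f)$ and $g\cong\mathrm{im}(g)\circ\mathrm{coim}(g)$. The following conditions are equivalent: (i) $\mathrm{im}(f)\simeq\ker(g)$, i.e. $\mathrm{im}(f)$ is a 2-kernel of $g$; (ii) $\operatorname{coker}(f)\simeq\mathrm{coim}(g)$, i.e. $\mathrm{coim}(g)$ is a 2-cokernel of $f$; (iii) the pair $(\mathrm{im}(f),\mathrm{coim}(g))$ is a short 2-exact sequence.
   Context: 2-categories are strict. For 1-cells, $\cong$ means that there is an invertible 2-cell between them. A bizero object of a 2-category $\mathcal L$ is an object $0$ such that for every object $A$ the hom-categories $\mathcal L(A,0)$ and $\mathcal L(0,A)$ are equivalent to the terminal category. A 1-cell is null if it factors through $0$; $f\cong 0$ means that $f$ is isomorphic to a null 1-cell. The bizero object is strong if between any two parallel 1-cells that factor through $0$ there is exactly one 2-cell. In a 2-category with a strong bizero object, a 2-kernel of $f\colon A\to B$ is a 1-cell $k\colon K\to A$ with an invertible 2-cell $f\circ k\cong 0$ such that (1) for every $z\colon Z\to A$ with $f\circ z\cong0$ there is $u\colon Z\to K$ with $k\circ u\cong z$; (2) for all $u,v\colon Z\to K$ and every 2-cell $\lambda\colon k\circ u\Rightarrow k\circ v$ there is a unique 2-cell $\mu\colon u\Rightarrow v$ whose whiskering with $k$ is $\lambda$. 2-cokernels are defined dually. They are unique up to equivalence and written $\ker(f)$,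 $\operatorname{coker}(f)$. A 2-z-exact 2-category is a 2-category with a strong bizero object having all 2-kernels and all 2-cokernels. A normal 2-monomorphism is a 1-cell which is a 2-kernel of some 1-cell; a normal 2-epimorphism is a 1-cell which is a 2-cokernel of some 1-cell. A 1-cell $f$ is normal if $f\cong m\circ e$ with $e$ a normal 2-epimorphism and $m$ a normal 2-monomorphism; this normal image factorisation is unique up to equivalence and one writes $m=\mathrm{im}(f)$, $e=\mathrm{coim}(f)$. A short 2-exact sequence is a composable pair $(k,q)$ such that $k$ is a 2-kernel of $q$ and $q$ is a 2-cokernel of $k$. *)

(* Defs.v *)
From Corelib Require Import ssreflect ssrbool.

Set Implicit Arguments.
Unset Strict Implicit.
Unset Printing Implicit Defensive.

Declare Scope cell_scope.
Delimit Scope cell_scope with cell.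
Local Open Scope cell_scope.

Record category := Category {
  obj :> Type;
  mor : obj -> obj -> Type;
  idm : forall x : obj, mor x x;
  compm : forall x y z : obj, mor y z -> mor x y -> mor x z;
  compm1 : forall (x y : obj) (a : mor x y), compm a (idm x) = a;
  comp1m : forall (x y : obj) (a : mor x y), compm (idm y) a = a;
  compmA : forall (x y z w : obj) (c : mor z w) (b : mor y z) (a : mor x y),
    compm c (compm b a) = compm (compm c b) a
}.

Notation "f ⇒ g" := (mor f g) (at level 70, no associativity) : cell_scope.
Notation "b • a" := (compm b a) (at level 40, left associativity) : cell_scope.

Definition invertible (C : category) (x y : C) (a : x ⇒ y) : Prop :=
  exists b : y ⇒ x, b • a = idm x /\ a • b = idm y.

Definition iso (C : category) (x y : C) : Prop :=
  exists a : x ⇒ y, invertible a.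

Notation "x ≅ y" := (iso x y) (at level 70, no associativity) : cell_scope.

Definition eq_mor (C : category) (x y : C) (p : x = y) : x ⇒ y :=
  match p in _ = z return x ⇒ z with eq_refl => idm x end.

Record functor (C D : category) := Functor {
  fobj :> C -> D;
  fmor : forall x y : C, (x ⇒ y) -> (fobj x ⇒ fobj y);
  fmor1 : forall x : C, fmor (idm x) = idm (fobj x);
  fmorM : forall (x y z : C) (b : y ⇒ z) (a : x ⇒ y),
    fmor (b • a) = fmor b • fmor a
}.

Definition idf (C : category) : functor C C :=
  @Functor C C (fun x => x) (fun _ _ a => a)
    (fun _ => eq_refl) (fun _ _ _ _ _ => eq_refl).

Definition compf (C D E : category) (G : functor D E) (F : functor C D) :
  functor C E :=
  @Functor C E (fun x => G (F x)) (fun _ _ a => fmor G (fmor F a))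
    (fun x => eq_trans (f_equal (@fmor _ _ G _ _) (fmor1 F x)) (fmor1 G (F x)))
    (fun _ _ _ b a => eq_trans (f_equal (@fmor _ _ G _ _) (fmorM F b a))
                               (fmorM G (fmor F b) (fmor F a))).

Definition naturally_isomorphic (C D : category) (F G : functor C D) : Prop :=
  exists t : forall x : C, F x ⇒ G x,
    (forall x : C, invertible (t x)) /\
    (forall (x y : C) (a : x ⇒ y), t y • fmor F a = fmor G a • t x).

Definition equivalent (C D : category) : Prop :=
  exists (F : functor C D) (G : functor D C),
    naturally_isomorphic (compf G F) (idf C) /\
    naturally_isomorphic (compf F G) (idf D).

Definition terminal_category : category :=
  @Category unit (fun _ _ => unit) (fun _ => tt) (fun _ _ _ _ _ => tt)
    (fun _ _ a => match a with tt => eq_refl end)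
    (fun _ _ a => match a with tt => eq_refl end)
    (fun _ _ _ _ _ _ _ => eq_refl).

(* Strict 2-categories, i.e. categories enriched in categories.  Composition
   of 1-cells is unital and associative up to equality; the corresponding laws
   for the horizontal composition of 2-cells relate 2-cells between equal, but
   not convertible, 1-cells, so they are stated modulo the identity 2-cells
   [eq_mor] carried by the equalities of 1-cells. *)
Record two_category := TwoCategory {
  cell0 :> Type;
  hom : cell0 -> cell0 -> category;
  id1 : forall A : cell0, hom A A;
  comp1 : forall A B C : cell0, hom B C -> hom A B -> hom A C;
  hcomp : forall (A B C : cell0) (g g' : hom B C) (f f' : hom A B),
    (g ⇒ g') -> (f ⇒ f') -> (comp1 g f ⇒ comp1 g' f');
  hcomp_id : forall (A B C : cell0) (g : hom B C) (f : hom A B),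
    hcomp (idm g) (idm f) = idm (comp1 g f);
  interchange : forall (A B C : cell0) (g g' g'' : hom B C) (f f' f'' : hom A B)
    (b' : g' ⇒ g'') (b : g ⇒ g') (a' : f' ⇒ f'') (a : f ⇒ f'),
    hcomp (b' • b) (a' • a) = hcomp b' a' • hcomp b a;
  comp1_idl : forall (A B : cell0) (f : hom A B), comp1 (id1 B) f = f;
  comp1_idr : forall (A B : cell0) (f : hom A B), comp1 f (id1 A) = f;
  comp1A : forall (A B C D : cell0) (h : hom C D) (g : hom B C) (f : hom A B),
    comp1 h (comp1 g f) = comp1 (comp1 h g) f;
  hcomp_idl : forall (A B : cell0) (f f' : hom A B) (a : f ⇒ f'),
    eq_mor (comp1_idl f') • hcomp (idm (id1 B)) a = a • eq_mor (comp1_idl f);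
  hcomp_idr : forall (A B : cell0) (f f' : hom A B) (a : f ⇒ f'),
    eq_mor (comp1_idr f') • hcomp a (idm (id1 A)) = a • eq_mor (comp1_idr f);
  hcompA : forall (A B C D : cell0) (h h' : hom C D) (g g' : hom B C)
    (f f' : hom A B) (c : h ⇒ h') (b : g ⇒ g') (a : f ⇒ f'),
    eq_mor (comp1A h' g' f') • hcomp c (hcomp b a)
    = hcomp (hcomp c b) a • eq_mor (comp1A h g f)
}.

Arguments hom {t} A B.
Arguments id1 {t} A.

Notation "g ∘ f" := (comp1 g f) (at level 40, left associativity) : cell_scope.

Definition whisker_left (L : two_category) (A B C : L) (k : hom B C)
  (u v : hom A B) (a : u ⇒ v) : k ∘ u ⇒ k ∘ v := hcomp (idm k) a.

Definition whisker_right (L : two_category) (A B C : L) (u v : hom B C)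
  (a : u ⇒ v) (q : hom A B) : u ∘ q ⇒ v ∘ q := hcomp a (idm q).

Definition bizero (L : two_category) (O : L) : Prop :=
  forall A : L, equivalent (hom A O) terminal_category /\
                equivalent (hom O A) terminal_category.

Definition null (L : two_category) (O A B : L) (f : hom A B) : Prop :=
  exists (s : hom A O) (t : hom O B), f = t ∘ s.

Definition iso_null (L : two_category) (O A B : L) (f : hom A B) : Prop :=
  exists n : hom A B, null O n /\ f ≅ n.

Definition strong_bizero (L : two_category) (O : L) : Prop :=
  bizero O /\
  forall (A B : L) (f g : hom A B), null O f -> null O g ->
    exists! a : f ⇒ g, True.

(* The structural invertible 2-cell between [f ∘ k] and a null 1-cell is only
   required to exist: when [O] is a strong bizero object, parallel null 1-cells
   are uniquely isomorphic, so this 2-cell carries no further data. *)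
Definition is_2kernel (L : two_category) (O A B K : L)
    (f : hom A B) (k : hom K A) : Prop :=
  iso_null O (f ∘ k) /\
  (forall (Z : L) (z : hom Z A), iso_null O (f ∘ z) ->
     exists u : hom Z K, k ∘ u ≅ z) /\
  (forall (Z : L) (u v : hom Z K) (l : k ∘ u ⇒ k ∘ v),
     exists! m : u ⇒ v, whisker_left k m = l).

Definition is_2cokernel (L : two_category) (O A B Q : L)
    (f : hom A B) (q : hom B Q) : Prop :=
  iso_null O (q ∘ f) /\
  (forall (Z : L) (z : hom B Z), iso_null O (z ∘ f) ->
     exists u : hom Q Z, u ∘ q ≅ z) /\
  (forall (Z : L) (u v : hom Q Z) (l : u ∘ q ⇒ v ∘ q),
     exists! m : u ⇒ v, whisker_right m q = l).

Record is_2z_exact (L : two_category) (O : L) : Prop := Is2ZExact {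
  z_exact_zero : strong_bizero O;
  z_exact_kernel : forall (A B : L) (f : hom A B),
    exists (K : L) (k : hom K A), is_2kernel O f k;
  z_exact_cokernel : forall (A B : L) (f : hom A B),
    exists (Q : L) (q : hom B Q), is_2cokernel O f q
}.

Definition normal_2mono (L : two_category) (O K A : L) (m : hom K A) : Prop :=
  exists (B : L) (f : hom A B), is_2kernel O f m.

Definition normal_2epi (L : two_category) (O B Q : L) (e : hom B Q) : Prop :=
  exists (A : L) (f : hom A B), is_2cokernel O f e.

Definition normal_image_factorisation (L : two_category) (O A B I : L)
    (f : hom A B) (m : hom I B) (e : hom A I) : Prop :=
  [/\ normal_2epi O e, normal_2mono O m & f ≅ m ∘ e].

Definition normal (L : two_category) (O A B : L) (f : hom A B) : Prop :=
  exists (I : L) (m : hom I B) (e : hom A I),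
    normal_image_factorisation O f m e.

Definition short_2exact (L : two_category) (O K A Q : L)
    (k : hom K A) (q : hom A Q) : Prop :=
  is_2kernel O q k /\ is_2cokernel O k q.

(* Main.v *)
Require Import Defs.
From Corelib Require Import ssreflect ssrbool.

Set Implicit Arguments.
Unset Strict Implicit.

Local Open Scope cell_scope.

(** Both (i) and (ii) turn out to be reformulations of (iii), for dual reasons.

    A 2-kernel [m] is fully faithful on 2-cells, hence reflects isomorphisms of
    1-cells; as all parallel null 1-cells are isomorphic, [m ∘ u ≅ 0] forces
    [u ≅ 0] ([mono_reflects_null]).  Consequently a 2-kernel of [g ≅ im_g ∘
    coim_g] is the same thing as a 2-kernel of [coim_g] ([kernel_of_comp]): the
    universal property of a 2-kernel of [g] only depends on which 1-cells are
    annihilated by [g].  Finally a normal 2-epimorphism is a 2-cokernel of each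
    of its 2-kernels ([normal_epi_coker_of_kernel]): if [q] is a 2-cokernel of
    [h] and [k] a 2-kernel of [q], then [h] factors through [k], so that
    whatever annihilates [k] annihilates [h].

    So [im_f] is a 2-kernel of [g] iff it is a 2-kernel of [coim_g], iff
    [(im_f, coim_g)] is short 2-exact; dually for the 2-cokernels of [f]. *)

(** * Isomorphic 1-cells and null 1-cells *)

Section Isomorphism.

Variable C : category.

Lemma iso_refl (x : C) : x ≅ x.
Proof. by exists (idm x), (idm x); rewrite compm1. Qed.

Lemma iso_sym (x y : C) : x ≅ y -> y ≅ x.
Proof. by move=> [a [b [ba ab]]]; exists b, a. Qed.

Lemma iso_trans (x y z : C) : x ≅ y -> y ≅ z -> x ≅ z.
Proof.
move=> [a [a' [a'a aa']]] [b [b' [b'b bb']]].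
exists (b • a), (a' • b'); split.
- by rewrite compmA -(compmA a' b' b) b'b compm1.
- by rewrite compmA -(compmA b a a') aa' compm1.
Qed.

End Isomorphism.

Section NullCells.

Variables (L : two_category) (O : L).

Lemma comp1_iso (A B C : L) (g g' : hom B C) (f f' : hom A B) :
  g ≅ g' -> f ≅ f' -> g ∘ f ≅ g' ∘ f'.
Proof.
move=> [b [b' [b'b bb']]] [a [a' [a'a aa']]].
exists (hcomp b a), (hcomp b' a').
by rewrite -!interchange b'b bb' a'a aa' !hcomp_id.
Qed.

Lemma iso_null_iso (A B : L) (f f' : hom A B) :
  f ≅ f' -> iso_null O f -> iso_null O f'.
Proof.
move=> ff' [n [n0 fn]]; exists n; split=> //.
exact: iso_trans (iso_sym ff') fn.
Qed.

Lemma null_comp_l (A B C : L) (g : hom B C) (f : hom A B) :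
  null O f -> null O (g ∘ f).
Proof. by move=> [s [t ->]]; exists s, (g ∘ t); rewrite comp1A. Qed.

Lemma null_comp_r (A B C : L) (g : hom B C) (f : hom A B) :
  null O g -> null O (g ∘ f).
Proof. by move=> [s [t ->]]; exists (s ∘ f), t; rewrite comp1A. Qed.

Lemma iso_null_comp_l (A B C : L) (g : hom B C) (f : hom A B) :
  iso_null O f -> iso_null O (g ∘ f).
Proof.
move=> [n [n0 fn]]; exists (g ∘ n); split; first exact: null_comp_l.
exact: comp1_iso (iso_refl g) fn.
Qed.

Lemma iso_null_comp_r (A B C : L) (g : hom B C) (f : hom A B) :
  iso_null O g -> iso_null O (g ∘ f).
Proof.
move=> [n [n0 gn]]; exists (n ∘ f); split; first exact: null_comp_r.
exact: comp1_iso gn (iso_refl f).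
Qed.

Hypothesis O0 : strong_bizero O.

Lemma exists_null (A B : L) : exists n : hom A B, null O n.
Proof.
have [_ [G _]] := proj1 (proj1 O0 A).
have [_ [H _]] := proj2 (proj1 O0 B).
by exists (H tt ∘ G tt), (G tt), (H tt).
Qed.

Lemma null_iso (A B : L) (f g : hom A B) : null O f -> null O g -> f ≅ g.
Proof.
move=> f0 g0.
have [a _] := proj2 O0 _ _ _ _ f0 g0.
have [b _] := proj2 O0 _ _ _ _ g0 f0.
(* the only 2-cell from a null 1-cell to itself is the identity *)
have endo (h : hom A B) (c : h ⇒ h) : null O h -> c = idm h.
  move=> h0; have [d [_ dU]] := proj2 O0 _ _ _ _ h0 h0.
  by rewrite -(dU c I) -(dU (idm h) I).
by exists a, b; split; apply: endo.
Qed.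

Lemma iso_null_iso_null (A B : L) (f g : hom A B) :
  iso_null O f -> null O g -> f ≅ g.
Proof. by move=> [n [n0 fn]] g0; apply: iso_trans fn (null_iso n0 g0). Qed.

End NullCells.

(** * Fully faithful and cofully faithful 1-cells *)

Section FullyFaithful.

Variable L : two_category.

(** Every functor [hom Z K -> hom Z A] given by composition with [k] is fully
    faithful; this is the two-dimensional part of the universal property of a
    2-kernel. *)
Definition fully_faithful (K A : L) (k : hom K A) : Prop :=
  forall (Z : L) (u v : hom Z K) (l : k ∘ u ⇒ k ∘ v),
    exists! m : u ⇒ v, whisker_left k m = l.

(** The dual notion, for 2-cokernels: precomposition with [q] is fully
    faithful. *)
Definition cofully_faithful (B Q : L) (q : hom B Q) : Prop :=
  forall (Z : L) (u v : hom Q Z) (l : u ∘ q ⇒ v ∘ q),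
    exists! m : u ⇒ v, whisker_right m q = l.

Lemma whisker_leftM (A B C : L) (k : hom B C) (u v w : hom A B)
    (b : v ⇒ w) (a : u ⇒ v) :
  whisker_left k (b • a) = whisker_left k b • whisker_left k a.
Proof. by rewrite /whisker_left -interchange compm1. Qed.

Lemma whisker_rightM (A B C : L) (u v w : hom B C)
    (b : v ⇒ w) (a : u ⇒ v) (q : hom A B) :
  whisker_right (b • a) q = whisker_right b q • whisker_right a q.
Proof. by rewrite /whisker_right -interchange compm1. Qed.

Lemma fully_faithful_reflects_iso (Z K A : L) (k : hom K A) (u v : hom Z K) :
  fully_faithful k -> k ∘ u ≅ k ∘ v -> u ≅ v.
Proof.
move=> kff [l [l' [l'l ll']]].
have [m [ml _]] := kff _ _ _ l; have [m' [ml' _]] := kff _ _ _ l'.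
have endo (w : hom Z K) (a : w ⇒ w) :
    whisker_left k a = idm (k ∘ w) -> a = idm w.
  move=> ka; have [d [_ dU]] := kff _ _ _ (idm (k ∘ w)).
  by rewrite -(dU _ ka) (dU (idm w)) // /whisker_left hcomp_id.
by exists m, m'; split; apply: endo; rewrite whisker_leftM ml ml'.
Qed.

Lemma cofully_faithful_reflects_iso (B Q Z : L) (q : hom B Q) (u v : hom Q Z) :
  cofully_faithful q -> u ∘ q ≅ v ∘ q -> u ≅ v.
Proof.
move=> qff [l [l' [l'l ll']]].
have [m [ml _]] := qff _ _ _ l; have [m' [ml' _]] := qff _ _ _ l'.
have endo (w : hom Q Z) (a : w ⇒ w) :
    whisker_right a q = idm (w ∘ q) -> a = idm w.
  move=> aq; have [d [_ dU]] := qff _ _ _ (idm (w ∘ q)).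
  by rewrite -(dU _ aq) (dU (idm w)) // /whisker_right hcomp_id.
by exists m, m'; split; apply: endo; rewrite whisker_rightM ml ml'.
Qed.

End FullyFaithful.

(** * 2-kernels and 2-cokernels *)

Section Kernels.

Variables (L : two_category) (O : L).
Hypothesis O0 : strong_bizero O.

Lemma mono_reflects_null (Z K A : L) (m : hom K A) (u : hom Z K) :
  normal_2mono O m -> iso_null O (m ∘ u) -> iso_null O u.
Proof.
move=> [B [f [_ [_ mff]]]] mu0.
have [n n0] := exists_null O0 Z K.
exists n; split=> //; apply: fully_faithful_reflects_iso mff _.
by apply: (iso_null_iso_null O0 mu0); apply: null_comp_l.
Qed.

Lemma epi_reflects_null (B Q Z : L) (e : hom B Q) (u : hom Q Z) :
  normal_2epi O e -> iso_null O (u ∘ e) -> iso_null O u.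
Proof.
move=> [A [f [_ [_ eff]]]] ue0.
have [n n0] := exists_null O0 Q Z.
exists n; split=> //; apply: cofully_faithful_reflects_iso eff _.
by apply: (iso_null_iso_null O0 ue0); apply: null_comp_r.
Qed.

(** A 2-kernel of a 1-cell depends only on the 1-cells which it annihilates. *)
Lemma kernel_of_same_annihilator (A B B' K : L) (f : hom A B) (f' : hom A B')
    (k : hom K A) :
  (forall (Z : L) (z : hom Z A), iso_null O (f ∘ z) <-> iso_null O (f' ∘ z)) ->
  is_2kernel O f k <-> is_2kernel O f' k.
Proof.
move=> ff'; split=> -[k0 [kf kff]]; (split; first exact/ff');
  by split=> // Z z z0; apply/kf/ff'.
Qed.

Lemma cokernel_of_same_annihilator (A A' B Q : L) (f : hom A B) (f' : hom A' B)
    (q : hom B Q) :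
  (forall (Z : L) (z : hom B Z), iso_null O (z ∘ f) <-> iso_null O (z ∘ f')) ->
  is_2cokernel O f q <-> is_2cokernel O f' q.
Proof.
move=> ff'; split=> -[q0 [qf qff]]; (split; first exact/ff');
  by split=> // Z z z0; apply/qf/ff'.
Qed.

Lemma kernel_of_comp (A B C K : L) (g : hom A C) (m : hom B C) (e : hom A B)
    (k : hom K A) :
  normal_2mono O m -> g ≅ m ∘ e -> is_2kernel O g k <-> is_2kernel O e k.
Proof.
move=> mM gme; apply: kernel_of_same_annihilator => Z z.
have gz : g ∘ z ≅ m ∘ (e ∘ z) by rewrite comp1A; apply/comp1_iso/iso_refl.
split=> z0.
- exact: mono_reflects_null mM (iso_null_iso gz z0).
- exact: iso_null_iso (iso_sym gz) (iso_null_comp_l m z0).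
Qed.

Lemma cokernel_of_comp (A B C Q : L) (f : hom A C) (m : hom B C) (e : hom A B)
    (q : hom C Q) :
  normal_2epi O e -> f ≅ m ∘ e -> is_2cokernel O f q <-> is_2cokernel O m q.
Proof.
move=> eE fme; apply: cokernel_of_same_annihilator => Z z.
have zf : z ∘ f ≅ (z ∘ m) ∘ e.
  by rewrite -comp1A; apply: comp1_iso fme; apply: iso_refl.
split=> z0.
- exact: epi_reflects_null eE (iso_null_iso zf z0).
- exact: iso_null_iso (iso_sym zf) (iso_null_comp_r e z0).
Qed.

Lemma normal_epi_coker_of_kernel (K B Q : L) (k : hom K B) (q : hom B Q) :
  normal_2epi O q -> is_2kernel O q k -> is_2cokernel O k q.
Proof.
move=> [A [h [qh0 [qf qff]]]] [qk0 [kf _]]; split=> //; split=> // Z z zk0.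
have [u kuh] := kf _ _ qh0.
apply: qf; apply: iso_null_iso (comp1_iso (iso_refl z) kuh) _.
by rewrite comp1A; apply: iso_null_comp_r.
Qed.

Lemma normal_mono_kernel_of_coker (K B Q : L) (k : hom K B) (q : hom B Q) :
  normal_2mono O k -> is_2cokernel O k q -> is_2kernel O q k.
Proof.
move=> [C [h [hk0 [kf kff]]]] [qk0 [qf _]]; split=> //; split=> // Z z qz0.
have [u uqh] := qf _ _ hk0.
apply: kf; apply: iso_null_iso (comp1_iso uqh (iso_refl z)) _.
by rewrite -comp1A; apply: iso_null_comp_l.
Qed.

End Kernels.

Theorem proposition4p4 :
  forall (L : two_category) (O : L), is_2z_exact O ->
  forall (A B C : L) (f : hom A B) (g : hom B C),
  normal O f -> normal O g ->
  forall (I : L) (im_f : hom I B) (coim_f : hom A I),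
  normal_image_factorisation O f im_f coim_f ->
  forall (J : L) (im_g : hom J C) (coim_g : hom B J),
  normal_image_factorisation O g im_g coim_g ->
  (is_2kernel O g im_f <-> is_2cokernel O f coim_g) /\
  (is_2cokernel O f coim_g <-> short_2exact O im_f coim_g).
Proof.
move=> L O [O0 _ _] A B C f g _ _ I im_f coim_f [cfE ifM ff] J im_g coim_g.
move=> [cgE igM gg].
have i_iii : is_2kernel O g im_f <-> short_2exact O im_f coim_g.
  apply: iff_trans (kernel_of_comp O0 im_f igM gg) _; split=> [ker | [] //].
  by split=> //; apply: normal_epi_coker_of_kernel.
have ii_iii : is_2cokernel O f coim_g <-> short_2exact O im_f coim_g.
  apply: iff_trans (cokernel_of_comp O0 coim_g cfE ff) _; split=> [coker | [] //].
  by split=> //; apply: normal_mono_kernel_of_coker.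
by split=> //; apply: iff_trans i_iii (iff_sym ii_iii).
Qed.
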